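(* In the 2D case, let $\mathcal{M}_Q^h$ (for $Q\in\mathbb{N}$) be the set of canonical decomposition interpolation functions with $Q$ modes, $$\mathcal{M}_Q^h=\left\{u^h \;\bigg|\; u^h(x,y)=\sum_{q=1}^Q \Big( \sum_{I=1}^{n_1} N_I(x)\beta_I^{(q)} \Big) \Big( \sum_{J=1}^{n_2} N_J(y)\gamma_J^{(q)} \Big),\ \beta_I^{(q)}, \gamma_J^{(q)} \in \mathbb{R}\right\},$$ and let $\mathcal{V}^h$ be the set of finite element interpolation functions $$\mathcal{V}^h=\left\{ u^h \;\bigg|\; u^h(x,y)=\sum_{I=1}^{n_1} \sum_{J=1}^{n_2} N_I(x)N_J(y)u_{(I,J)},\ u_{(I,J)}\in\mathbb{R}\right\},$$ both built on the same 1D shape functions. Then $$\forall\, Q\in\mathbb{N},\ Q\geq \min(n_1,n_2):\qquad \mathcal{M}_Q^h=\mathcal{V}^h .$$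
   Context: The sets are based on a regular 2D mesh (product of a 1D grid with $n_1$ nodes in the $x$ direction and a 1D grid with $n_2$ nodes in the $y$ direction). $N_I(x)$, $I=1,\dots,n_1$, denote the 1D finite element shape functions attached to the $x$-nodes, and $N_J(y)$, $J=1,\dots,n_2$, the 1D finite element shape functions attached to the $y$-nodes (two separate families, distinguished by the variable; e.g. piecewise linear hat functions). Indices range over $I=1,\dots,n_1$, $J=1,\dots,n_2$, $q=1,\dots,Q$. *)

(* Defs.v *)
From HB Require Import structures.
From mathcomp Require Import all_boot all_order all_algebra.
From mathcomp Require Import boolp classical_sets reals.

Set Implicit Arguments.
Unset Strict Implicit.
Unset Printing Implicit Defensive.

Import Order.TTheory GRing.Theory Num.Theory.

Local Open Scope classical_set_scope.
Local Open Scope ring_scope.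

(* The shape functions [Nx] (one per x-node) and [Ny] (one per y-node) are two
   separate, arbitrary families of real functions: no property of a particular
   finite element is assumed.  Nodes and modes are numbered from 0. *)

Definition cd_interp (R : realType) (n1 n2 : nat)
    (Nx : 'I_n1 -> R -> R) (Ny : 'I_n2 -> R -> R) (Q : nat) :
    set (R -> R -> R) :=
  [set u | exists (beta : 'I_Q -> 'I_n1 -> R) (gamma : 'I_Q -> 'I_n2 -> R),
     forall x y : R,
       u x y = \sum_(q < Q) (\sum_(I < n1) Nx I x * beta q I)
                          * (\sum_(J < n2) Ny J y * gamma q J)].

Definition fe_interp (R : realType) (n1 n2 : nat)
    (Nx : 'I_n1 -> R -> R) (Ny : 'I_n2 -> R -> R) : set (R -> R -> R) :=
  [set u | exists c : 'I_n1 -> 'I_n2 -> R,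
     forall x y : R,
       u x y = \sum_(I < n1) \sum_(J < n2) Nx I x * Ny J y * c I J].

(* Main.v *)
(* Evaluating a canonical decomposition with modes [beta], [gamma] amounts to
   the finite element interpolation of the coefficient matrix beta^T gamma, so
   the claim is that every n1 x n2 matrix factors through dimension Q.  This
   holds as soon as Q is at least its rank, which is at most min(n1, n2). *)

Require Import Defs.
From HB Require Import structures.
From mathcomp Require Import all_boot all_order all_algebra.
From mathcomp Require Import boolp classical_sets reals.

Set Implicit Arguments.
Unset Strict Implicit.
Unset Printing Implicit Defensive.

Import Order.TTheory GRing.Theory Num.Theory.

Local Open Scope classical_set_scope.
Local Open Scope ring_scope.

(** In the Gaussian normal form of [A], the middle partial identity has rank at most [k], so it
    splits into two partial identities through dimension [k]. *)
Lemma mulmx_factor (F : fieldType) (m n k : nat) (A : 'M[F]_(m, n)) :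
  (\rank A <= k)%N ->
  exists (B : 'M[F]_(m, k)) (C : 'M[F]_(k, n)), A = B *m C.
Proof.
move=> rk; exists (col_ebase A *m pid_mx (\rank A)).
exists (pid_mx (\rank A) *m row_ebase A).
rewrite mulmxA -(mulmxA (col_ebase A)) mul_pid_mx minnn (minn_idPr rk).
by rewrite mulmx_ebase.
Qed.

(** Serves both inclusions: the inner sum over [q] is the nodal coefficient. *)
Lemma sum_prod_modes (R : comPzRingType) (m n k : nat)
    (f : 'I_m -> R) (g : 'I_n -> R) (b : 'I_k -> 'I_m -> R)
    (c : 'I_k -> 'I_n -> R) :
  \sum_(q < k) (\sum_(i < m) f i * b q i) * (\sum_(j < n) g j * c q j) =
  \sum_(i < m) \sum_(j < n) f i * g j * \sum_(q < k) b q i * c q j.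
Proof.
under eq_bigr => q _ do rewrite mulr_suml.
rewrite exchange_big; apply: eq_bigr => i _ /=.
under eq_bigr => q _ do rewrite mulr_sumr.
rewrite exchange_big; apply: eq_bigr => j _ /=.
by rewrite mulr_sumr; apply: eq_bigr => q _; rewrite mulrACA.
Qed.

Theorem theorem2 (R : realType) (n1 n2 : nat)
    (Nx : 'I_n1 -> R -> R) (Ny : 'I_n2 -> R -> R) (Q : nat)
    (hQ : (minn n1 n2 <= Q)%N) :
  cd_interp Nx Ny Q = fe_interp Nx Ny.
Proof.
apply/seteqP; split=> u /=.
  move=> [beta [gamma uE]].
  exists (fun I J => \sum_(q < Q) beta q I * gamma q J) => x y.
  by rewrite uE sum_prod_modes.
move=> [c uE]; pose A := \matrix_(I < n1, J < n2) c I J.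
have rkA : (\rank A <= Q)%N.
  by rewrite (leq_trans _ hQ) // leq_min rank_leq_row rank_leq_col.
have [B [C AE]] := mulmx_factor rkA.
(* Mode [q] pairs column [q] of [B] with row [q] of [C]: [A] is the sum of these outer products. *)
exists (fun q I => B I q), (fun q J => C q J) => x y.
rewrite uE sum_prod_modes; apply: eq_bigr => I _; apply: eq_bigr => J _.
by have := congr1 (fun M : 'M_(n1, n2) => M I J) AE; rewrite !mxE => ->.
Qed.
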